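(* Let $\alpha: G_0\curvearrowright X$ be a distal action of an infinite amenable countable discrete group $G_0$ on the Cantor set $X$ such that the free points of $\alpha$ are dense. Let $T$ be a finite symmetric subset of $[[\alpha]]$ containing $\mathrm{id}_X$. For each $\varphi\in T$, choose a continuous orbit cocycle $c(\varphi):X \to G_0$, write $S=\bigcup_{\varphi\in T}\operatorname{ran}(c(\varphi))\subset G_0$, where $\operatorname{ran}(c(\varphi))$ is the range of $c(\varphi)$, and suppose $S$ is symmetric and contains $e_{G_0}$. Let $G=\langle S\rangle\le G_0$ and $\Gamma=\langle T\rangle\leq [[\alpha]]$. Then there is an $l\in \mathbb{N}$ depending only on $T$ such that for any $\epsilon>0$ (for which $\delta(\epsilon)$ below is defined) one has $$\operatorname{F{\o}l}_{\Gamma, T}(\epsilon)\leq \Big(\sum_{i=1}^{n}\Phi_{S, \delta(\epsilon)}(i)\Big)^l,$$ where $$\delta(\epsilon)= \min\left\{\frac{\epsilon}{(1+2|T|)\cdot 2^l|T|^2\cdot 2|S|(|S|+2)},\ 1-\sqrt{1-\frac{\epsilon}{(1+2|T|)\cdot 2^l|T|^2\cdot 2|S|}}\right\}$$ and $n=\lceil\log(\delta(\epsilon))/\log(1-\delta(\epsilon))\rceil$.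
   Context: An action $\alpha:G_0\curvearrowright X$ is distal if $\inf_{g}d(gx,gy)>0$ whenever $x\neq y$ ($d$ a compatible metric on $X$). A point is free if its stabilizer is trivial. $[[\alpha]]$ is the group of all homeomorphisms $\varphi$ of $X$ for which there is a continuous map $c(\varphi):X\to G_0$ ($G_0$ discrete), called a continuous orbit cocycle, with $\varphi(x)=\alpha_{c(\varphi)(x)}(x)$ for all $x\in X$. For a group $\Lambda$ generated by a finite set $Q$: $\partial_Q^-F=\{g\in F: Qg\not\subset F\}$ for finite $F\subset\Lambda$, and $\operatorname{F{\o}l}_{\Lambda,Q}(\epsilon)=\min\{|F|: F\subset\Lambda\text{ finite nonempty}, |\partial_Q^-F|\leq\epsilon|F|\}$. For $G$ generated by the finite symmetric set $S\ni e$: $B(G,r)$ is the closed ball of radius $r$ around $e$ in the Cayley graph of $(G,S)$, so that $B(G,1)=S$; $\operatorname{Vol}(r)=|B(G,r)|$; and for $\epsilon>0$, $$\psi(\epsilon)=\min\{r\in\mathbb{N}_+: \text{there exists } F\subset B(G, r)\text{ with } |\partial_S^-F|\leq \epsilon|F|\text{ and } |F|=\operatorname{F{\o}l}_{G, S}(\epsilon)\}.$$ For $\epsilon>0$ the functions $\Phi_{S,\epsilon},\varphi_{S,\epsilon}:\mathbb{N}_+\to\mathbb{N}_+$ are defined recursively by $\Phi_{S,\epsilon}(1)=\varphi_{S,\epsilon}(1)=|S|$ and, with $$\eta_m=\frac{\epsilon}{16\cdot\varphi_{S,\epsilon}(m)\cdot\big(\sum_{i=1}^m\Phi_{S,\epsilon}(i)\big)^2\cdot(|S|+1)},$$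 by $\Phi_{S,\epsilon}(m+1)=\operatorname{F{\o}l}_{G,S}(\eta_m)$ and $\varphi_{S,\epsilon}(m+1)=\max\{\varphi_{S,\epsilon}(m),\operatorname{Vol}(\psi(\eta_m))\}$. *)

(* Defs.v *)
From HB Require Import structures.
From mathcomp Require Import all_boot all_order all_algebra finmap.
From mathcomp Require Import all_classical all_reals all_analysis.

Set Implicit Arguments.
Unset Strict Implicit.
Unset Printing Implicit Defensive.

Import Order.TTheory GRing.Theory Num.Theory.

Local Open Scope classical_set_scope.
Local Open Scope ring_scope.

Section Homeomorphisms.

Definition homeomorphism (X Y : topologicalType) (f : X -> Y) : Prop :=
  continuous f /\
  exists g : Y -> X, [/\ continuous g, cancel f g & cancel g f].

Definition cantor_set (X : topologicalType) : Prop :=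
  exists f : X -> cantor_space, homeomorphism f.

Record homeo (X : topologicalType) := Homeo {
  homeo_fun :> X -> X;
  homeoP : homeomorphism homeo_fun
}.

HB.instance Definition _ (X : topologicalType) := gen_eqMixin (homeo X).
HB.instance Definition _ (X : topologicalType) := gen_choiceMixin (homeo X).

Variable X : topologicalType.
Implicit Types phi psi : homeo X.

Lemma homeo_ext phi psi : phi =1 psi -> phi = psi.
Proof.
case: phi psi => [f hf] [g hg] /= /funext fg; subst g.
by congr Homeo; exact: Prop_irrelevance.
Qed.

Lemma homeomorphism_id : homeomorphism (@id X).
Proof. by split=> [x|]; [exact: cvg_id | exists id; split => // x; exact: cvg_id]. Qed.

Definition homeo_one : homeo X := Homeo homeomorphism_id.

Lemma homeomorphism_comp phi psi : homeomorphism (phi \o psi).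
Proof.
case: phi psi => [f [cf [f' [cf' ff' f'f]]]] [g [cg [g' [cg' gg' g'g]]]] /=.
split=> [x|]; first by apply: continuous_comp; [exact: cg | exact: cf].
exists (g' \o f'); split; [|exact: can_comp|exact: can_comp].
by move=> x; apply: continuous_comp; [exact: cf' | exact: cg'].
Qed.

Definition homeo_mul phi psi : homeo X := Homeo (homeomorphism_comp phi psi).

Definition homeo_invfun phi : X -> X := projT1 (cid (homeoP phi).2).

Lemma homeo_invfunP phi :
  [/\ continuous (homeo_invfun phi), cancel phi (homeo_invfun phi)
    & cancel (homeo_invfun phi) phi].
Proof. by rewrite /homeo_invfun; case: cid. Qed.

Lemma homeomorphism_inv phi : homeomorphism (homeo_invfun phi).
Proof.
have [ci pi ip] := homeo_invfunP phi.
by split=> //; exists phi; split=> //; case: (homeoP phi).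
Qed.

Definition homeo_inv phi : homeo X := Homeo (homeomorphism_inv phi).

Lemma homeo_mulA : associative homeo_mul.
Proof. by move=> f g h; exact: homeo_ext. Qed.
Lemma homeo_mul1 : left_id homeo_one homeo_mul.
Proof. by move=> f; exact: homeo_ext. Qed.
Lemma homeo_1mul : right_id homeo_one homeo_mul.
Proof. by move=> f; exact: homeo_ext. Qed.
Lemma homeo_mulV : left_inverse homeo_one homeo_inv homeo_mul.
Proof. by move=> f; apply: homeo_ext => x /=; have [_ ->] := homeo_invfunP f. Qed.
Lemma homeo_Vmul : right_inverse homeo_one homeo_inv homeo_mul.
Proof. by move=> f; apply: homeo_ext => x /=; have [_ _ ->] := homeo_invfunP f. Qed.

End Homeomorphisms.

(* The product of homeo X is composition: (phi * psi)%g x = phi (psi x). *)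
HB.instance Definition _ (X : topologicalType) := isGroup.Build (homeo X)
  (@homeo_mulA X) (@homeo_mul1 X) (@homeo_1mul X) (@homeo_mulV X) (@homeo_Vmul X).

Section Actions.
Context {R : realType} {X : metricType R} {G : groupType}.
Variable alpha : G -> X -> X.

Definition continuous_action : Prop :=
  [/\ forall g, continuous (alpha g),
      forall x, alpha 1%g x = x
    & forall g h x, alpha (g * h)%g x = alpha g (alpha h x)].

Definition distal : Prop :=
  forall x y : X, x <> y ->
    0 < inf (range (fun g : G => mdist (alpha g x) (alpha g y))).

Definition free_points : set X :=
  [set x | forall g, alpha g x = x -> g = 1%g].

Definition orbit_cocycle (phi : homeo X) (c : X -> G) : Prop :=
  continuous (c : X -> discrete_topology G) /\
  forall x, phi x = alpha (c x) x.

Definition topological_full_group : set (homeo X) :=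
  [set phi | exists c : X -> G, orbit_cocycle phi c].

End Actions.

(* Amenability of a discrete group, in the form of the Folner condition. *)
Definition amenable (R : realType) (G : groupType) : Prop :=
  forall (K : {fset G}) (eps : R), 0 < eps ->
    exists F : {fset G}, F != fset0 /\
      forall g, g \in K ->
        let gF := [fset (g * h)%g | h in F]%fset in
        #|` (gF `\` F) `|` (F `\` gF) |%fset%:R <= eps * #|` F|%:R.

(* The least element of A, and the junk value 0 when A is empty. *)
Definition min_nat (A : set nat) : nat :=
  xget 0%N [set m | A m /\ forall k, A k -> (m <= k)%N].

Section Folner.
Context {R : realType} {G : groupType}.
Implicit Types (Q F S : {fset G}) (eps : R).

Definition symmetric_fset Q : Prop := forall g, g \in Q -> g^-1%g \in Q.

Definition generated Q : set G :=
  smallest (fun H : set G => group_closed [in H]) [set` Q].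

Definition inner_boundary Q F : {fset G} :=
  [fset g in F | ~~ ([fset (q * g)%g | q in Q] `<=` F)]%fset.

(* The cardinalities whose minimum is Fol_{L,Q}(eps); this set may be empty
   for general L, in which case folner L Q eps is meaningless. *)
Definition folner_sizes (L : set G) Q eps : set nat :=
  [set k | exists F, [/\ F != fset0, [set` F] `<=` L,
    #|` inner_boundary Q F|%:R <= eps * #|` F|%:R & #|` F| = k]].

Definition folner (L : set G) Q eps : nat := min_nat (folner_sizes L Q eps).

(* Vertices at distance at most r from 1 in the Cayley graph with edges
   between g and s * g for s in S; S is symmetric wherever this is used. *)
Fixpoint cayley_ball S (r : nat) : {fset G} :=
  if r is r'.+1 then
    (cayley_ball S r' `|`
     [fset (s * g)%g | s in S, g in cayley_ball S r'])%fset
  else [fset 1%g]%fset.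

Definition growth S (r : nat) : nat := #|` cayley_ball S r|.

Definition psi S eps : nat :=
  min_nat [set r | (0 < r)%N /\ exists F,
    [/\ (F `<=` cayley_ball S r)%fset,
        #|` inner_boundary S F|%:R <= eps * #|` F|%:R
      & #|` F| = folner (generated S) S eps]].

(* Here v stands for varphi(m) and s for \sum_(1 <= i < m + 1) Phi i. *)
Definition eta_of S eps (v s : nat) : R :=
  eps / (16 * v%:R * s%:R ^+ 2 * (#|` S|%:R + 1)).

(* Phi, varphi and the partial sums of Phi, computed together; entry m of this
   sequence is (Phi (m + 1), varphi (m + 1), \sum_(1 <= i < m + 2) Phi i). *)
Fixpoint Phi_rec S eps (m : nat) : nat * nat * nat :=
  if m is m'.+1 then
    let: (_, v, s) := Phi_rec S eps m' in
    let eta := eta_of S eps v s in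
    let p := folner (generated S) S eta in
    (p, maxn v (growth S (psi S eta)), (s + p)%N)
  else (#|` S|, #|` S|, #|` S|).

(* Phi and varphi are functions on positive integers: the value at 0 is junk. *)
Definition Phi S eps (m : nat) : nat := (Phi_rec S eps m.-1).1.1.
Definition varphi S eps (m : nat) : nat := (Phi_rec S eps m.-1).1.2.

Definition eta S eps (m : nat) : R :=
  eta_of S eps (varphi S eps m) (\sum_(1 <= i < m.+1) Phi S eps i)%N.

Lemma Phi_rec_sum S eps m :
  (Phi_rec S eps m).2 = (\sum_(1 <= i < m.+2) Phi S eps i)%N.
Proof.
elim: m => [|m IHm]; first by rewrite big_nat1.
rewrite big_nat_recr //= -IHm /Phi /=.
by case: (Phi_rec S eps m) => [[p v] s].
Qed.

Lemma Phi1 S eps : Phi S eps 1 = #|` S|. Proof. by []. Qed.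

Lemma varphi1 S eps : varphi S eps 1 = #|` S|. Proof. by []. Qed.

Lemma PhiS S eps m : (0 < m)%N ->
  Phi S eps m.+1 = folner (generated S) S (eta S eps m).
Proof.
case: m => // m _; rewrite /eta -Phi_rec_sum /varphi /Phi /=.
by case: (Phi_rec S eps m) => [[p v] s].
Qed.

Lemma varphiS S eps m : (0 < m)%N ->
  varphi S eps m.+1 = maxn (varphi S eps m) (growth S (psi S (eta S eps m))).
Proof.
case: m => // m _; rewrite /eta -Phi_rec_sum /varphi /=.
by case: (Phi_rec S eps m) => [[p v] s].
Qed.

End Folner.

Section Delta.
Context {R : realType}.

(* Here t = |T| and s = |S|. *)
Definition delta_ratio (t s l : nat) (eps : R) : R :=
  eps / ((1 + 2 * t%:R) * 2 ^+ l * t%:R ^+ 2 * (2 * s%:R)).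

(* delta is meant for delta_ratio t s l eps <= 1: Num.sqrt is 0 on negative
   arguments. *)
Definition delta (t s l : nat) (eps : R) : R :=
  Num.min
    (eps / ((1 + 2 * t%:R) * 2 ^+ l * t%:R ^+ 2 * (2 * s%:R * (s%:R + 2))))
    (1 - Num.sqrt (1 - delta_ratio t s l eps)).

(* The ratio of logarithms is positive for 0 < d < 1. *)
Definition num_levels (d : R) : nat := `|Num.ceil (ln d / ln (1 - d))|%N.

End Delta.

(* Main.v *)
Require Import Defs.
From HB Require Import structures.
From mathcomp Require Import all_boot all_order all_algebra finmap perm.
From mathcomp Require Import all_classical all_reals all_analysis.
From mathcomp Require Import ring lra.

Set Implicit Arguments.
Unset Strict Implicit.
Unset Printing Implicit Defensive.

Import Order.TTheory GRing.Theory Num.Theory.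
Local Open Scope classical_set_scope.
Local Open Scope ring_scope.

(** The proof has a dynamical half and a combinatorial half.

    Dynamics. Let G be the group generated by S. A distal action of a finitely
    generated group on a compact space is rigid enough that finitely many
    cocycles can be trapped in a finite invariant structure: there is a finite
    partition of X into clopen classes, given by a map kappa : X -> P, which
    refines the level sets of every c(phi) with phi in T and whose classes are
    permuted by G ([equivariant_partition]). Two points are put in the same
    class when the cocycles agree along their whole G-orbits; the point is that
    agreement along a ball of some fixed radius r already implies it
    ([recurrence_radius]). Otherwise a limiting argument in X * X produces a
    pair y in a clopen set U and a map p in the Ellis semigroup of G such that
    the orbit of p y avoids U. Distality makes every element of the Ellis
    semigroup left invertible ([distal_left_inverse]), so y is a limit of the
    orbit of p y, a contradiction.

    Combinatorics. An element of T now acts on the class i by an element of S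
    depending only on i, while it permutes the classes, so that the group
    generated by T behaves as a subgroup of the wreath product of G with the
    permutations of P. If F is a Folner set of G, then the pairs of a map
    P -> F and a permutation of P form a Folner set of this wreath product; its
    relative boundary is at most #|P| times that of F ([folner_wreath]). A
    Folner set for a free action restricts to one orbit, hence to a Folner set
    of the acting group of no larger size ([folner_transfer]). So
    Fol_T(#|P| eta) <= Fol_S(eta) ^ #|P| * #|P|! for every eta > 0.

    Numerics. Taking eta = eta_1 gives Fol_S(eta_1) = Phi(2), and n >= 2
    because delta <= 1/3; hence both Phi(2) and 2 are at most the sum of the
    Phi(i). With l = #|P| + #|P|! the factor #|P|! is absorbed by a power of
    the sum, and #|P| eta_1 <= eps because delta <= eps / 2 ^ l. By
    density of the free points the cocycles, hence S, are determined by T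
    ([orbit_cocycle_unique]), which is why l can be chosen before them. *)

(** * Least elements, generated subgroups and balls *)

Lemma min_natP (A : set nat) : A !=set0 ->
  A (min_nat A) /\ forall k, A k -> (min_nat A <= k)%N.
Proof.
move=> [k Ak].
have exA : exists m, `[< A m >] by exists k; apply/asboolP.
have [m /asboolP Am leA] := ex_minnP exA.
apply: (@xgetPex nat 0%N [set m | A m /\ forall k, A k -> (m <= k)%N]).
by exists m; split => // i Ai; apply: leA; apply/asboolP.
Qed.

Section Generated.
Context {G : groupType} (S : {fset G}).

Lemma generated_group : group_closed [in generated S].
Proof.
split=> [|g h]; first by rewrite inE => H [[H1 _] _]; rewrite inE in H1.
rewrite !inE => Lg Lh H [[H1 HM] SH].
have := HM g h; rewrite !inE; apply; [exact: Lg | exact: Lh].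
Qed.

Lemma generated1 : generated S 1%g.
Proof. by have [] := generated_group; rewrite inE. Qed.

Lemma generatedM g h : generated S g -> generated S h -> generated S (g * h)%g.
Proof.
by have := group_closedM generated_group (x := g) (y := h); rewrite !inE.
Qed.

Lemma mem_generated g : g \in S -> generated S g.
Proof. by move=> Sg H [_]; apply. Qed.

Lemma generated_ind (P : G -> Prop) :
  P 1%g -> (forall g h, P g -> P h -> P (g * h)%g) ->
  (forall g, P g -> P g^-1%g) -> (forall s, s \in S -> P s) ->
  forall g, generated S g -> P g.
Proof.
move=> P1 PM PV PS g /(_ [set g | P g]); apply; split => //.
by split=> [|x y]; rewrite !inE //= => Px Py; apply: PM => //; apply: PV.
Qed.

Lemma cayley_ball_generated r g : g \in cayley_ball S r -> generated S g.
Proof.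
elim: r g => [|r IHr] g /=; first by rewrite inE => /eqP ->; exact: generated1.
rewrite inE => /orP[/IHr //|/imfset2P [s /= Ss [h /= /IHr Lh] ->]].
by apply: generatedM => //; exact: mem_generated.
Qed.

Lemma cayley_ball1 r : 1%g \in cayley_ball S r.
Proof. by elim: r => [|r IHr] /=; rewrite !inE ?IHr. Qed.

Lemma cayley_ballS r g :
  g \in cayley_ball S r -> g \in cayley_ball S r.+1.
Proof. by rewrite /= in_fsetU => ->. Qed.

Lemma cayley_ball_mul r s g :
  s \in S -> g \in cayley_ball S r -> (s * g)%g \in cayley_ball S r.+1.
Proof.
move=> Ss Bg; rewrite /= in_fsetU; apply/orP; right.
by apply/imfset2P; exists s => //; exists g.
Qed.

Lemma cayley_ballSP r g : 1%g \in S -> g \in cayley_ball S r.+1 ->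
  exists s h, [/\ s \in S, h \in cayley_ball S r & g = (s * h)%g].
Proof.
move=> S1; rewrite /= in_fsetU => /orP[Bg|/imfset2P [s /= Ss [h /= Bh ->]]].
  by exists 1%g, g; rewrite mul1g.
by exists s, h.
Qed.

Lemma cayley_ball_mulr r s g : 1%g \in S ->
  s \in S -> g \in cayley_ball S r -> (g * s)%g \in cayley_ball S r.+1.
Proof.
move=> S1 Ss; elim: r g => [|r IHr] g.
  rewrite inE => /eqP ->; rewrite mul1g -[s]mulg1.
  by apply: cayley_ball_mul; rewrite ?inE.
move=> /(cayley_ballSP S1) [t [h [St Bh ->]]]; rewrite -mulgA.
by apply: cayley_ball_mul => //; exact: IHr.
Qed.

Lemma cayley_ballV r g : 1%g \in S -> symmetric_fset S ->
  g \in cayley_ball S r -> g^-1%g \in cayley_ball S r.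
Proof.
move=> S1 SV; elim: r g => [|r IHr] g.
  by rewrite !inE => /eqP ->; rewrite invg1.
move=> /(cayley_ballSP S1) [t [h [St Bh ->]]]; rewrite invgM.
by apply: cayley_ball_mulr => //; [exact: SV | exact: IHr].
Qed.

Lemma cayley_ball_le m n g : (m <= n)%N ->
  g \in cayley_ball S m -> g \in cayley_ball S n.
Proof.
move=> /subnKC <-; elim: (n - m)%N => [|k IHk]; rewrite ?addn0 // addnS => /IHk.
exact: cayley_ballS.
Qed.

Lemma generated_cayley_ball g : 1%g \in S -> symmetric_fset S ->
  generated S g -> exists r, g \in cayley_ball S r.
Proof.
move=> S1 SV; move: g; apply: generated_ind => [|g h [m Bg] [n Bh]|g [m Bg]|s Ss].
- by exists 0%N; rewrite inE.
- exists (m + n)%N; elim: m g Bg => [|m IHm] g.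
    by rewrite inE => /eqP ->; rewrite mul1g.
  move=> /(cayley_ballSP S1) [s [k [Ss Bk ->]]]; rewrite -mulgA addSn.
  by apply: cayley_ball_mul => //; exact: IHm.
- by exists m; exact: cayley_ballV.
- by exists 1%N; rewrite -[s]mulg1; apply: cayley_ball_mul => //; rewrite inE.
Qed.

End Generated.

(** * Folner sets of free actions *)

Definition action_boundary {H : groupType} {Y : choiceType} (a : H -> Y -> Y)
    (T : {fset H}) (E : {fset Y}) : {fset Y} :=
  [fset y in E | [exists t : T, a (val t) y \notin E]]%fset.

Lemma action_boundaryP {H : groupType} {Y : choiceType} (a : H -> Y -> Y)
    (T : {fset H}) (E : {fset Y}) y :
  reflect (y \in E /\ exists2 t, t \in T & a t y \notin E)
          (y \in action_boundary a T E).
Proof.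
rewrite !inE /=; apply: (iffP andP) => [[Ey /existsP[t]]|[Ey [t Tt ty]]].
  by split => //; exists (val t) => //; exact: valP.
by split=> //; apply/existsP; exists [` Tt]%fset.
Qed.

Lemma inner_boundaryP {H : groupType} (Q F : {fset H}) g :
  reflect (g \in F /\ exists2 t, t \in Q & (t * g)%g \notin F)
          (g \in inner_boundary Q F).
Proof.
rewrite !inE /=; apply: (iffP andP) => [[Fg /fsubsetPn[h]]|[Fg [t Qt tg]]].
  by move=> /imfsetP[t /= Qt ->] ?; split => //; exists t.
split=> //; apply/fsubsetPn; exists (t * g)%g => //.
by apply/imfsetP; exists t.
Qed.

(** An invariant predicate cuts E without creating new boundary points. *)
Lemma action_boundary_restrict {H : groupType} {Y : choiceType}
    (a : H -> Y -> Y) (T : {fset H}) (E : {fset Y}) (P : pred Y) :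
  (forall t z, t \in T -> P (a t z) = P z) ->
  action_boundary a T [fset z in E | P z]%fset =
  [fset z in action_boundary a T E | P z]%fset.
Proof.
move=> PT.
have inP (A : {fset Y}) x : (x \in [fset z in A | P z]%fset) = (x \in A) && P x.
  by rewrite !inE.
apply/fsetP => z; rewrite inP andbC; apply/action_boundaryP/andP; rewrite inP.
  move=> [/andP[Ez Pz] [t Tt]]; rewrite inP PT // Pz andbT => tz.
  by split=> //; apply/action_boundaryP; split=> //; exists t.
move=> [Pz /action_boundaryP[Ez [t Tt tz]]]; rewrite Ez Pz; split=> //.
by exists t => //; rewrite inP PT // Pz andbT.
Qed.

Section Transfer.
Context {R : realType} {H : groupType} {Y : choiceType} (a : H -> Y -> Y).
Variables (L : set H) (T : {fset H}).
Hypothesis a1 : forall y, a 1%g y = y.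
Hypothesis aM : forall g h y, a (g * h)%g y = a g (a h y).
Hypothesis grL : group_closed [in L].
Hypothesis TL : [set` T] `<=` L.

Let L1 : L 1%g. Proof. by case: grL; rewrite inE. Qed.

Let LM g h : L g -> L h -> L (g * h)%g.
Proof. by have := group_closedM grL (x := g) (y := h); rewrite !inE. Qed.

Let LV g : L g -> L g^-1%g.
Proof. by have := group_closedV grL (x := g); rewrite !inE. Qed.

(** E is the disjoint union of its traces on the L-orbits, and so is its
    boundary; if every trace had too large a boundary, so would E. *)
Lemma folner_in_orbit (eps : R) (E : {fset Y}) : E != fset0 ->
  #|` action_boundary a T E|%:R <= eps * #|` E|%:R ->
  exists y O, [/\ y \in E /\ O != fset0,
    forall z, z \in O -> exists2 g, L g & z = a g y,
    #|` action_boundary a T O|%:R <= eps * #|` O|%:R & (#|` O| <= #|` E|)%N].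
Proof.
have [n] := ubnP #|` E|; elim: n E => // n IHn E ltEn E0 leE.
have /fset0Pn [y Ey] := E0.
pose inO z := `[< exists2 g, L g & z = a g y >].
pose O := [fset z in E | inO z]%fset.
pose O' := [fset z in E | ~~ inO z]%fset.
have Oy : y \in O by rewrite !inE Ey; apply/asboolP; exists 1%g; rewrite ?a1.
have inO_T t z : t \in T -> inO (a t z) = inO z.
  move=> Tt; have Lt := TL Tt; apply/asbool_equiv_eq; split=> -[g Lg].
    move=> e; exists (t^-1 * g)%g; first by apply: LM => //; exact: LV.
    by rewrite aM -e -aM mulVg a1.
  by move=> ->; exists (t * g)%g; rewrite ?aM//; apply: LM.
have bO : action_boundary a T O = [fset z in action_boundary a T E | inO z]%fset.
  exact: action_boundary_restrict.
have bO' : action_boundary a T O' = [fset z in action_boundary a T E | ~~ inO z]%fset.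
  apply: (@action_boundary_restrict _ _ _ _ _ (fun z => ~~ inO z)) => t z Tt.
  by rewrite inO_T.
have splitO (A : {fset Y}) :
    #|` A| = (#|` [fset z in A | inO z]%fset| + #|` [fset z in A | ~~ inO z]%fset|)%N.
  rewrite -(cardfsID [fset z in A | inO z]%fset A); congr (_ + _)%N; congr #|` _|;
  by apply/fsetP => z; rewrite !inE; case: (z \in A); rewrite ?andbT ?andbF.
have [leO|gtO] := lerP #|` action_boundary a T O|%:R (eps * #|` O|%:R).
  exists y, O; split=> //.
  - by split=> //; apply/fset0Pn; exists y.
  - by move=> z; rewrite !inE => /andP[_ /asboolP].
  - by rewrite (splitO E) leq_addr.
have O'lt : (#|` O'| < #|` E|)%N.
  rewrite (splitO E) -[X in (X < _)%N]add0n ltn_add2r cardfs_gt0.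
  by apply/fset0Pn; exists y.
have leO' : #|` action_boundary a T O'|%:R <= eps * #|` O'|%:R.
  move: leE; rewrite (splitO E) (splitO (action_boundary a T E)) -bO -bO' !natrD mulrDr.
  move=> le1; rewrite -(lerD2l (eps * #|` O|%:R)) (le_trans _ le1) //.
  by rewrite lerD2r ltW.
have O'0 : O' != fset0.
  apply/eqP => O'0; move: gtO; rewrite ltNge => /negP; apply.
  move: leE; rewrite (splitO E) (splitO (action_boundary a T E)) -bO -bO'.
  have -> : action_boundary a T O' = fset0.
    by apply/fsetP => z; rewrite O'0 !inE.
  by rewrite -/O' O'0 !cardfs0 !addn0.
have [|z [W [[zO' W0] WL bW leW]]] := IHn O' _ O'0 leO'.
  by apply: leq_trans O'lt _; rewrite -ltnS.
exists z, W; split=> //; last by apply: leq_trans leW _; exact: ltnW.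
by split=> //; move: zO'; rewrite !inE => /andP[].
Qed.

(** A free orbit is a copy of L, on which the action becomes left
    multiplication: a Folner set inside an orbit is a Folner set of L. *)
Lemma folner_transfer (eps : R) (E : {fset Y}) :
  (forall g y, y \in E -> a g y = y -> g = 1%g) -> E != fset0 ->
  #|` action_boundary a T E|%:R <= eps * #|` E|%:R ->
  exists2 k, folner_sizes L T eps k & (k <= #|` E|)%N.
Proof.
move=> a_free E0 /(folner_in_orbit E0) [y [Z [[Ey Z0] ZL bZ leZ]]].
exists #|` Z| => //.
pose f z := xget 1%g [set g | L g /\ z = a g y].
have fP z : z \in Z -> L (f z) /\ a (f z) y = z.
  move=> /ZL [g Lg ->].
  by have [] : [set h | L h /\ a g y = a h y] (f (a g y))
    by apply: xgetPex; exists g.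
have a_inj g h : a g y = a h y -> g = h.
  move=> e; have : a (h^-1 * g)%g y = y by rewrite aM e -aM mulVg a1.
  by move/(a_free _ _ Ey)/mulg1_eq; rewrite invgK.
pose F := [fset f z | z in Z]%fset.
have f_inj : {in Z &, injective f}.
  by move=> u v Zu Zv e; rewrite -(fP _ Zu).2 -(fP _ Zv).2 e.
have cF : #|` F| = #|` Z| by rewrite card_in_imfset.
exists F; split=> //.
- have /fset0Pn [z Zz] := Z0; apply/fset0Pn; exists (f z).
  by apply/imfsetP; exists z.
- by move=> g /= /imfsetP [z /= Zz ->]; have [] := fP _ Zz.
- rewrite cF; apply: le_trans bZ; rewrite ler_nat.
  have /fsubset_leq_card : (inner_boundary T F `<=`
      [fset f z | z in action_boundary a T Z])%fset.
    apply/fsubsetP => g /inner_boundaryP [/imfsetP [z /= Zz ->] [t Tt tz]].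
    apply/imfsetP; exists z => //=; apply/action_boundaryP; split=> //.
    exists t => //; apply: contra tz => tz; apply/imfsetP; exists (a t z) => //=.
    by apply: a_inj; rewrite aM (fP _ Zz).2 (fP _ tz).2.
  move=> /leq_trans; apply; exact: leq_imfset_card.
Qed.

End Transfer.

(** * The Ellis semigroup of a distal system *)

Lemma compact_directed_cap {M : topologicalType} {I : Type} (D : set I)
    (f : I -> set M) :
  compact [set: M] -> (exists i, D i) ->
  (forall i j, D i -> D j -> exists2 k, D k & f k `<=` f i `&` f j) ->
  (forall i, D i -> closed (f i)) -> (forall i, D i -> f i !=set0) ->
  exists p, forall i, D i -> f i p.
Proof.
move=> cM D0 Ddir fcl f0.
have FF : ProperFilter (filter_from D f).
  by apply: filter_from_proper => //; exact: filter_from_filter.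
have [|p [_ clp]] := cM _ FF; first exact: filterT.
exists p => i Di; apply: fcl => // B pB.
by apply: clp => //; exists i.
Qed.

(** The Ellis-Numakura lemma. In a minimal closed subsemigroup A and for u in
    A, both A u and the set of v in A with v u = u are closed subsemigroups,
    hence equal to A; so u itself satisfies u u = u. *)
Lemma closed_semigroup_idempotent (M : topologicalType) (mul : M -> M -> M)
    (C : set M) :
  compact [set: M] -> hausdorff_space M -> associative mul ->
  (forall u, continuous (mul ^~ u)) ->
  closed C -> C !=set0 -> (forall f g, C f -> C g -> C (mul f g)) ->
  exists2 u, C u & mul u u = u.
Proof.
move=> cM hM mulA mulc Ccl C0 CM.
pose semi (A : set M) := closed A /\ (forall f g, A f -> A g -> A (mul f g)).
pose P := [set B : set M | semi (~` B) /\ ~` B `&` C !=set0].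
(* Zorn's lemma yields maximal sets, so it is applied to complements. *)
have [|B [[[Acl AM] AC0] Bmax]] := @Zorn_bigcup M P.
  move=> F FP Ftot; rewrite /P /= setC_bigcup.
  split; first split.
  - by apply: closed_bigI => A /FP [[]].
  - move=> f g Ff Fg A FA; have [[_ HM] _] := FP _ FA.
    by apply: HM; [exact: Ff | exact: Fg].
  have [[A FA]|F0] := pselect (exists A, F A); last first.
    by have [x Cx] := C0; exists x; split=> // A FA; case: F0; exists A.
  have [||||p Fp] := @compact_directed_cap M (set M) F (fun A => ~` A `&` C) cM.
  - by exists A.
  - move=> A1 A2 F1 F2; have [A12|A21] := Ftot _ _ F1 F2.
      exists A2 => // x [A2x Cx]; split => //; split=> // A1x.
      by apply: A2x; exact: A12.
    exists A1 => // x [A1x Cx]; split => //; split=> // A2x.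
    by apply: A1x; exact: A21.
  - by move=> D /FP [[? _] _]; exact: closedI.
  - by move=> D /FP [].
  exists p; split; last by have [] := Fp _ FA.
  by move=> D FD; have [] := Fp _ FD.
pose A := ~` B `&` C.
have Amin D : D `<=` A -> semi D -> D !=set0 -> D = A.
  move=> DA semiD [d Dd].
  have DB : D = ~` B.
    apply: contrapT => neq; apply: (Bmax (~` D)).
      split; last by move=> DB; apply: neq; apply/seteqP; split=> [x /DA []//|x Bx];
        apply: contrapT => nDx; apply: Bx; exact: DB.
      by move=> x Bx Dx; have [] := DA _ Dx.
    rewrite /P /= setCK; split=> //; exists d; split=> //.
    by have [] := DA _ Dd.
  by apply/seteqP; split=> // x [Bx _]; rewrite DB.
have semiA : semi A.
  split; first exact: closedI.
  by move=> f g [? ?] [? ?]; split; [exact: AM | exact: CM].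
have [u Au] := AC0; exists u; first by case: Au.
have D1 : mul ^~ u @` A = A.
  apply: Amin.
  - by move=> _ [f Af <-]; apply: semiA.2.
  - split; last first.
      move=> _ _ [f Af <-] [g Ag <-]; exists (mul (mul f u) g).
        by apply: semiA.2 => //; exact: semiA.2.
      by rewrite !mulA.
    apply: compact_closed => //; apply: continuous_compact.
      by apply: continuous_subspaceT => x; exact: mulc.
    by apply: (subclosed_compact _ cM) => //; exact: semiA.1.
  - by exists (mul u u); exists u.
have [v Av vu] : (mul ^~ u @` A) u by rewrite D1.
have D2 : A `&` [set v | mul v u = u] = A.
  apply: Amin; first by move=> x [].
    split; last first.
      move=> f g [Af fu] [Ag gu]; split; first exact: semiA.2.
      by rewrite /= -mulA gu.
    apply: closedI; first exact: semiA.1.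
    apply: (@preimage_closed _ _ (mul ^~ u) [set u]).
      by move=> x _; exact: mulc.
    by apply: accessible_closed_set1; exact: hausdorff_accessible.
  by exists v.
by have [_ ->] : (A `&` [set v | mul v u = u]) u by rewrite D2.
Qed.

Lemma ptws_continuous {S X : topologicalType} {Y : uniformType}
    (h : S -> {ptws X -> Y}) :
  (forall x, continuous (fun s => h s x)) -> continuous h.
Proof.
move=> hc s.
have FF : Filter (h @ s) by exact: fmap_filter.
by apply: (iffRL (pointwise_cvgP (F := h @ s) (h s : X -> Y) _)) => x; exact: hc.
Qed.

Lemma compact_ptws (X : topologicalType) :
  compact [set: X] -> compact [set: {ptws X -> X}].
Proof.
move=> cX; have := @tychonoff X (fun=> X) (fun=> setT) (fun=> cX).
by congr compact; apply/seteqP; split.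
Qed.

Section Enveloping.
Context {R : realType} {X : metricType R}.
Hypothesis cX : compact [set: X].
Variable L : set (X -> X).
Hypothesis Lc : forall g, L g -> continuous g.
Hypothesis LM : forall g h, L g -> L h -> L (g \o h).

Let M : topologicalType := {ptws X -> X}.
Let E : set M := closure (L : set M).

Let compactM : compact [set: M]. Proof. exact: compact_ptws. Qed.

Let hausdorffM : hausdorff_space M.
Proof. by apply: (@hausdorff_product X (fun=> X)) => x; exact: metric_hausdorff. Qed.

Let compr (u : X -> X) : M -> M := fun f => f \o u.
Let compl (g : X -> X) : M -> M := fun f => g \o f.

Let compr_continuous (u : X -> X) : continuous (compr u).
Proof.
apply: ptws_continuous => x f.
exact: (@proj_continuous X (fun=> X) (u x) f).
Qed.

Let compl_continuous (g : X -> X) : continuous g ->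
  continuous (compl g).
Proof.
move=> cg; apply: ptws_continuous => x f.
apply: (@continuous_comp _ _ _ (fun f : M => f x) g); last exact: cg.
exact: (@proj_continuous X (fun=> X) x f).
Qed.

(** Right composition with any map is continuous, left composition only with
    a continuous one; this is why p is varied last. *)
Lemma closure_compose (p q : X -> X) :
  closure (L : set {ptws X -> X}) p -> closure (L : set {ptws X -> X}) q ->
  closure (L : set {ptws X -> X}) (p \o q).
Proof.
move=> Ep Eq.
have clE (h : M -> M) : continuous h -> closed (h @^-1` E).
  by move=> ch; apply: preimage_closed; [move=> x _; exact: ch | exact: closed_closure].
have LE g : L g -> E (g \o q).
  move=> Lg; suff /(_ q Eq) : E `<=` compl g @^-1` E by [].
  rewrite [X in X `<=` _]closureE; apply: smallest_sub.
    by apply: clE; apply: compl_continuous; exact: Lc.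
  by move=> h Lh; apply: subset_closure; exact: LM.
suff /(_ p Ep) : E `<=` compr q @^-1` E by [].
rewrite [X in X `<=` _]closureE; apply: smallest_sub; last exact: LE.
by apply: clE; exact: compr_continuous.
Qed.

Lemma closure_approx2 (q : X -> X) x y A B :
  closure (L : set {ptws X -> X}) q ->
  nbhs (q x) A -> nbhs (q y) B -> exists g, [/\ L g, A (g x) & B (g y)].
Proof.
move=> Eq qA qB.
have [|g [Lg [Ag Bg]]] := Eq ((fun f => f x) @^-1` A `&` (fun f => f y) @^-1` B).
  apply: filterI; first exact: (@proj_continuous X (fun=> X) x q A qA).
  exact: (@proj_continuous X (fun=> X) y q B qB).
by exists g.
Qed.

Hypothesis L_distal : forall x y,
  (forall e, 0 < e -> exists2 g, L g & mdist (g x) (g y) < e) -> x = y.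

(** The closed left ideal E p contains an idempotent u. For such u the points x
    and u x have the same image under u, hence are proximal, hence equal; so u
    is the identity, and it has the form q p. *)
Lemma distal_left_inverse (p : X -> X) : closure (L : set {ptws X -> X}) p ->
  exists2 q : X -> X, closure (L : set {ptws X -> X}) q & forall x, q (p x) = x.
Proof.
move=> Ep.
have [||||||u [q Eq <-] uu] := @closed_semigroup_idempotent M
  (fun f g => f \o g) (compr p @` E) compactM.
- exact: hausdorffM.
- by [].
- exact: compr_continuous.
- apply: compact_closed; first exact: hausdorffM.
  apply: continuous_compact.
    by apply: continuous_subspaceT => x; exact: compr_continuous.
  by apply: (subclosed_compact _ compactM) => //; exact: closed_closure.
- by exists (p \o p); exists p.
- move=> _ _ [f Ef <-] [g Eg <-]; exists (f \o p \o g) => //.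
  by do 2! apply: closure_compose => //.
exists q => // x; apply/esym/L_distal => e e0.
pose z := q (p x).
have Eu : E (q \o p) by exact: closure_compose.
have uz : q (p z) = z by have := congr1 (@^~ x) uu.
have e20 : 0 < e / 2 by rewrite divr_gt0.
(* Both x and z are mapped to z by q p, hence close to z by some g. *)
have [|||g [Lg gx gz]] := @closure_approx2 (q \o p) x z
  (ball z (e / 2)) (ball z (e / 2)).
- exact: Eu.
- exact: nbhsx_ballx.
- by rewrite /= uz; exact: nbhsx_ballx.
exists g => //; have : ball (g x) e (g z).
  by rewrite [e]splitr; apply: ball_triangle gz; exact: ball_sym.
by rewrite ballEmdist.
Qed.

End Enveloping.

(** * Equivariant finite partitions *)

Lemma ptws_eval2_continuous {X : eqType} {Y : topologicalType} (x1 x2 : X) :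
  continuous (fun f : {ptws X -> Y} => (f x1, f x2)).
Proof.
move=> f; apply: cvg_pair.
- exact: (@nbhs_filter {ptws X -> Y} f).
- exact: (@proj_continuous X (fun=> Y) x1 f).
- exact: (@proj_continuous X (fun=> Y) x2 f).
Qed.

Section DistalAction.
Context {R : realType} {X : metricType R} {G : groupType}.
Variables (alpha : G -> X -> X) (S : {fset G}).
Hypothesis cX : compact [set: X].
Hypothesis alphaP : continuous_action alpha.
Hypothesis alpha_distal : distal alpha.
Hypothesis S1 : 1%g \in S.
Hypothesis SV : symmetric_fset S.

Let alphac g : continuous (alpha g). Proof. by case: alphaP => + _ _; apply. Qed.
Let alpha1 x : alpha 1%g x = x. Proof. by case: alphaP => _ + _; apply. Qed.
Let alphaM g h x : alpha (g * h)%g x = alpha g (alpha h x).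
Proof. by case: alphaP. Qed.

Lemma distal_separated x y :
  (forall e, 0 < e -> exists g, mdist (alpha g x) (alpha g y) < e) -> x = y.
Proof.
move=> small; apply: contrapT => /alpha_distal inf0.
have [g] := small _ inf0; rewrite ltNge => /negP; apply.
apply: ge_inf; last by exists g.
by exists 0 => _ [h _ <-]; exact: mdist_ge0.
Qed.

Let alpha2 g (w : X * X) := (alpha g w.1, alpha g w.2).

Let alpha2c g : continuous (alpha2 g).
Proof.
move=> w; apply: cvg_pair.
  by apply: (@continuous_comp _ _ _ fst (alpha g)); [exact: cvg_fst|exact: alphac].
by apply: (@continuous_comp _ _ _ snd (alpha g)); [exact: cvg_snd|exact: alphac].
Qed.

Let alpha2M g h w : alpha2 (g * h)%g w = alpha2 g (alpha2 h w).
Proof. by rewrite /alpha2 !alphaM. Qed.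

(** Uniform recurrence: in a distal system an orbit of pairs cannot stay
    outside the clopen set U for an arbitrarily long time before it visits U.
    If it could, then looking backwards from the first visit and passing to a
    limit gives y in U such that balls of any radius in its orbit avoid U, and
    then p in the Ellis semigroup such that the orbit of p y avoids U. *)
Lemma recurrence_radius (U : set (X * X)) : closed U -> open U ->
  exists r, forall w, (forall b, b \in cayley_ball S r -> ~ U (alpha2 b w)) ->
    forall b, b \in cayley_ball S r.+1 -> ~ U (alpha2 b w).
Proof.
move=> Ucl Uop; apply: contrapT => noR.
have {noR} far r : exists w, (forall b, b \in cayley_ball S r -> ~ U (alpha2 b w)) /\
    exists2 b, b \in cayley_ball S r.+1 & U (alpha2 b w).
  apply: contrapT => noW; apply: noR; exists r => w wr b Bb Ub.
  by apply: noW; exists w; split=> //; exists b.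
(* From the visit y to U, some h of length at most m + 1 leads back to a point
   whose ball of radius m avoids U. *)
pose A m := U `&` \bigcup_(h in [set` cayley_ball S m.+1])
   \bigcap_(b in [set` cayley_ball S m]) (alpha2 (b * h)%g) @^-1` (~` U).
have Acl m : closed (A m).
  apply: closedI => //; apply: closed_bigcup => // h _; apply: closed_bigI => b _.
  apply: preimage_closed; first by move=> x _; exact: alpha2c.
  exact: open_closedC.
have AS m : A m.+1 `<=` A m.
  move=> y [Uy [h Bh yh]]; split=> //.
  have [s [h' [Ss Bh' hE]]] : exists s h', [/\ s \in S,
      h' \in cayley_ball S m.+1 & h = (s * h')%g] by exact: cayley_ballSP.
  exists h' => //= b /= Bb.
  have := yh (b * s^-1)%g; rewrite hE /= !mulgA mulgVK; apply.
  by apply: cayley_ball_mulr => //; exact: SV.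
have Ale m n : (m <= n)%N -> A n `<=` A m.
  move=> /subnKC <-; elim: (n - m)%N => [|k IHk]; first by rewrite addn0.
  by rewrite addnS; apply: subset_trans (AS _) IHk.
have A0 m : A m !=set0.
  have [w [wm [b Bb Ub]]] := far m; exists (alpha2 b w); split=> //.
  exists b^-1%g; first by apply: cayley_ballV.
  by move=> b' /= Bb'; rewrite -alpha2M mulgVK; exact: wm.
have cXX : compact [set: X * X] by rewrite -setXTT; exact: compact_setX.
have [||||y Ay] := @compact_directed_cap _ nat setT A cXX.
- by exists 0%N.
- move=> m n _ _; exists (maxn m n) => // y yA.
  by split; apply: Ale yA; rewrite ?leq_maxl ?leq_maxr.
- by [].
- by [].
have Uy : U y by have [] := Ay 0%N I.
have hex m : exists h, h \in cayley_ball S m.+1 /\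
    forall b, b \in cayley_ball S m -> ~ U (alpha2 (b * h)%g y).
  by have [_ [h /= Bh hy]] := Ay m I; exists h.
have [h hP] := choice hex.
pose M : topologicalType := {ptws X -> X}.
pose L : set (X -> X) := [set alpha g | g in generated S].
have cM : compact [set: M] := compact_ptws cX.
have [|p [_ clp]] := cM ((fun m => alpha (h m) : M) @ \oo) _; first exact: filterT.
have Lp : closure (L : set M) p.
  move=> B pB; apply: clp => //; exists 0%N => // m _; exists (h m) => //.
  by apply: (@cayley_ball_generated _ _ m.+1); have [] := hP m.
have pU g : generated S g -> ~ U (alpha2 g (p y.1, p y.2)).
  move=> /(generated_cayley_ball S1 SV) [r Bg].
  pose ev (f : M) : X * X := (f y.1, f y.2).
  have evc : continuous ev by exact: ptws_eval2_continuous.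
  have : closed ((alpha2 g \o ev) @^-1` (~` U)).
    apply: preimage_closed; last exact: open_closedC.
    by move=> f _; apply: continuous_comp; [exact: evc | exact: alpha2c].
  apply => B pB; apply: clp => //; exists r => // m /= rm.
  have := (hP m).2 g; rewrite alpha2M; apply; exact: cayley_ball_le Bg.
(* y = q (p y) is a limit of the orbit of p y, which must therefore enter U. *)
have [|||q Lq qp] := @distal_left_inverse R X cX L _ _ _ p Lp.
- by move=> _ [g _ <-]; exact: alphac.
- move=> _ _ [f Lf <-] [g Lg <-]; exists (f * g)%g; first exact: generatedM.
  by apply/funext => x /=; rewrite alphaM.
- move=> x1 x2 small; apply: distal_separated => e /small [_ [g _ <-] ?].
  by exists g.
have [[B1 B2] /= [yB1 yB2] BU] : nbhs y U by apply: open_nbhs_nbhs.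
have yB1' : nbhs (q (p y.1)) B1 by rewrite qp.
have yB2' : nbhs (q (p y.2)) B2 by rewrite qp.
have [_ [[g Lg <-] Bg1 Bg2]] := closure_approx2 Lq yB1' yB2'.
by apply: (pU g Lg); apply: BU.
Qed.

(** Points are classified by the values of all cocycles along the ball of
    radius r. By the choice of r this determines the values along the ball of
    radius r + 1, which makes the classification S-equivariant. *)
Lemma equivariant_partition (K : choiceType) (T : {fset K}) (c : K -> X -> G) :
  (forall k, k \in T -> forall x, \forall x' \near x, c k x' = c k x) ->
  (forall k, k \in T -> forall x, c k x \in S) ->
  exists (P : finType) (kappa : X -> P),
    [/\ forall i, exists x, kappa x = i,
        forall x, \forall x' \near x, kappa x' = kappa x,
        forall k, k \in T -> forall x y, kappa x = kappa y -> c k x = c k y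
      & forall s, s \in S -> forall x y, kappa x = kappa y ->
          kappa (alpha s x) = kappa (alpha s y)].
Proof.
move=> c_lc cS.
pose U : set (X * X) := [set w | exists2 k, k \in T & c k w.1 <> c k w.2].
have U_lc w : \forall w' \near w, U w' <-> U w.
  pose V (k : T) : set (X * X) := [set w' |
      c (val k) w'.1 = c (val k) w.1 /\ c (val k) w'.2 = c (val k) w.2].
  have near_c (k : T) : nbhs w (V k).
    apply: filterI.
      exact: (@cvg_fst _ _ (nbhs w.1) (nbhs w.2) _ _ (c_lc _ (valP k) w.1)).
    exact: (@cvg_snd _ _ (nbhs w.1) (nbhs w.2) _ _ (c_lc _ (valP k) w.2)).
  apply: filterS (@filter_forall _ _ V _ _ near_c) => w' cw.
  split=> -[k Tk]; have /= [e1 e2] := cw [` Tk]%fset.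
    by rewrite e1 e2; exists k.
  by rewrite -e1 -e2; exists k.
have Uop : open U.
  by rewrite openE => w Uw; apply: filterS (U_lc w) => w' [_]; apply.
have Ucl : closed U.
  by move=> w clU; have [w' [Uw' [+ _]]] := clU _ (U_lc w); apply.
have [r rP] := recurrence_radius Ucl Uop.
pose code x : {ffun cayley_ball S r * T -> S} :=
  [ffun bk => insubd [` S1]%fset (c (val bk.2) (alpha (val bk.1) x))].
have codeP x y : code x = code y <-> forall b k, b \in cayley_ball S r -> k \in T ->
    c k (alpha b x) = c k (alpha b y).
  split=> [e b k Bb Tk|e].
    have /(congr1 val) :=
      congr1 (fun f : {ffun _ -> _} => f ([` Bb], [` Tk])%fset) e.
    by rewrite !ffunE /= !insubdK //; exact: cS.
  by apply/ffunP => -[b k]; rewrite !ffunE /= (e _ _ (valP b) (valP k)).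
(* Only the codes that occur are kept, so that no class is empty. *)
pose P := {i : {ffun cayley_ball S r * T -> S} | `[< exists x, code x = i >]}.
pose kappa x : P := exist _ (code x) (asboolT (ex_intro _ x erefl)).
have kappaP x y : kappa x = kappa y <-> code x = code y.
  by split=> [/(congr1 val)//|e]; exact: val_inj.
exists P, kappa; split.
- move=> [i ix]; have /asboolP [x xi] := ix; exists x.
  exact: val_inj.
- move=> x; pose V (bk : cayley_ball S r * T) : set X := [set x' |
      c (val bk.2) (alpha (val bk.1) x') = c (val bk.2) (alpha (val bk.1) x)].
  have near_code (bk : cayley_ball S r * T) : nbhs x (V bk).
    exact: (alphac (c_lc _ (valP bk.2) (alpha (val bk.1) x))).
  apply: filterS (@filter_forall _ _ V _ _ near_code) => x' cx.
  apply/kappaP/codeP => b k Bb Tk.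
  exact: (cx ([` Bb], [` Tk])%fset).
- move=> k Tk x y /kappaP/codeP/(_ 1%g k (cayley_ball1 _ _) Tk).
  by rewrite !alpha1.
- move=> s Ss x y /kappaP/codeP e; apply/kappaP/codeP => b k Bb Tk.
  have := rP (x, y) _ _ (cayley_ball_mulr S1 Ss Bb).
  rewrite /alpha2 /= !alphaM => noU; apply: contrapT => ne; apply: noU.
    by move=> b' Bb' [k' Tk']; apply; exact: e.
  by exists k.
Qed.

End DistalAction.

(** * Folner sets of wreath products *)

Lemma leq_card_exists (A J : finType) (b : J -> pred A) :
  (#|[pred x | [exists j, b j x]]| <= \sum_j #|b j|)%N.
Proof.
rewrite -sum1_card big_mkcond.
rewrite (eq_bigr (fun j => \sum_x (b j x : nat))%N); last first.
  by move=> j _; rewrite -sum1_card big_mkcond.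
rewrite exchange_big; apply: leq_sum => x _ /=; rewrite inE.
by case: existsP => // -[j bj]; rewrite (bigD1 j) //= bj.
Qed.

Lemma card_ffun_coord (I J : finType) (B : pred J) (i : I) :
  (#|[pred u : {ffun I -> J} | B (u i)]| * #|J| = #|B| * #|J| ^ #|I|)%N.
Proof.
pose V j : pred J := if j == i then B else predT.
have -> : #|[pred u : {ffun I -> J} | B (u i)]| = #|family V|.
  apply: eq_card => u; rewrite inE; apply/idP/familyP => [Bu j|/(_ i)]; rewrite /V.
    by have [->|] := eqVneq j i.
  by rewrite eqxx.
rewrite card_family.
have -> : foldr muln 1%N [seq #|V x| | x : I] = (\prod_j #|V j|)%N.
  by rewrite foldrE big_map big_enum.
rewrite (bigD1 i) //= {1}/V eqxx -mulnA; congr (_ * _)%N.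
rewrite (eq_bigr (fun=> #|J|)); last first.
  by move=> j /negPf; rewrite /V => ->; exact: eq_card.
rewrite prod_nat_const -expnSr; congr (_ ^ _)%N.
by rewrite cardC1 prednK //; apply/card_gt0P; exists i.
Qed.

Section Wreath.
Context {R : realType} {X : topologicalType} {G : groupType} {P : finType}.
Variables (alpha : G -> X -> X) (S : {fset G}) (T : {fset homeo X}).
Variables (c : homeo X -> X -> G) (kappa : X -> P) (rho : P -> X).
Hypothesis alpha1 : forall x, alpha 1%g x = x.
Hypothesis alphaM : forall g h x, alpha (g * h)%g x = alpha g (alpha h x).
Hypothesis SV : symmetric_fset S.
Hypothesis TV : symmetric_fset T.
Hypothesis cS : forall phi, phi \in T -> forall x, c phi x \in S.
Hypothesis cP : forall phi, phi \in T -> forall x, phi x = alpha (c phi x) x.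
Hypothesis c_kappa : forall phi, phi \in T -> forall x y,
  kappa x = kappa y -> c phi x = c phi y.
Hypothesis kappa_S : forall s, s \in S -> forall x y,
  kappa x = kappa y -> kappa (alpha s x) = kappa (alpha s y).
Hypothesis rhoK : cancel rho kappa.
Hypothesis rho_free : forall i g, alpha g (rho i) = rho i -> g = 1%g.

(** The space acted upon. A map w records, at each current position x, where x
    came from and a label; a homeomorphism acts by moving the positions, that
    is by precomposition with its inverse. In this model the action of the
    whole group of homeomorphisms is explicit, and a cocycle is needed only for
    the elements of T. *)
Let Y := X -> X * P.
Let precomp (g : homeo X) (w : Y) : Y := fun x => w ((g^-1)%g x).

Let kappa_T phi x y : phi \in T ->
  kappa x = kappa y -> kappa (phi x) = kappa (phi y).
Proof.
move=> Tphi xy; rewrite !cP // -(c_kappa Tphi xy).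
by apply: kappa_S => //; exact: cS.
Qed.

(** To u : P -> F and a permutation q corresponds the map w (u, q) which says
    that a point of class i came from its image under the inverse of u i, with
    label q i. These maps form the Folner set E. The action on E is free:
    labels recover the classes and then the origins recover the points. Free
    points in all classes make (u, q) |-> w (u, q) injective. An element of T
    moves w (u, q) inside E unless some u i lies in the boundary of F. *)
Lemma folner_wreath (eta : R) (F : {fset G}) : F != fset0 ->
  #|` inner_boundary S F|%:R <= eta * #|` F|%:R ->
  exists2 k, folner_sizes (generated T) T (#|P|%:R * eta) k &
    (k <= #|` F| ^ #|P| * #|{perm P}|)%N.
Proof.
move=> F0 leF.
pose w (uq : {ffun P -> F} * {perm P}) : Y :=
  fun x => (alpha (val (uq.1 (kappa x)))^-1%g x, uq.2 (kappa x)).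
have w_inj : injective w.
  move=> [u q] [u' q'] e.
  have wx i : w (u, q) (rho i) = w (u', q') (rho i) by rewrite e.
  congr (_, _); last by apply/permP => i; have [_] := wx i; rewrite !rhoK.
  apply/ffunP => i; have [+ _] := wx i; rewrite rhoK /= => ui.
  apply/esym/val_inj/divg1_eq/(@rho_free i).
  by rewrite alphaM ui -alphaM mulgV alpha1.
pose E : {fset Y} := [fset w uq | uq in {: {ffun P -> F} * {perm P}}]%fset.
have wE uq : w uq \in E by apply/imfsetP; exists uq.
have card_E : #|` E| = (#|` F| ^ #|P| * #|{perm P}|)%N.
  by rewrite card_imfset //= -cardE card_prod card_ffun -cardfE.
pose bF : pred F := fun g => val g \in inner_boundary S F.
have card_bF : #|bF| = #|` inner_boundary S F|.
  have -> : #|bF| = #|` [fset val g | g in bF]%fset|.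
    by rewrite card_imfset; [rewrite -cardE | exact: val_inj]. 
  congr #|` _|; apply/fsetP => g.
  apply/imfsetP/idP => [[h /= bh ->] //|bg].
  have /inner_boundaryP [Fg _] := bg.
  by exists [` Fg]%fset.
pose bad j := [pred uq : {ffun P -> F} * {perm P} | bF (uq.1 j)].
have bdE : (action_boundary precomp T E `<=`
    [fset w uq | uq in [pred uq | [exists j, bad j uq]]])%fset.
  apply/fsubsetP => y /action_boundaryP [/imfsetP [[u q] /= _ ->] [phi Tphi]].
  move=> nE; apply/imfsetP; exists (u, q) => //=.
  suff : [exists j, bF (u j)] by [].
  apply: contraT => /existsPn good; move/negP: nE; case.
  (* The maps in E are precomposed with psi, which is again in T. *)
  pose psi := (phi^-1)%g; have Tpsi : psi \in T by exact: TV.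
  pose psibar i := kappa (psi (rho i)).
  have psibarE x : kappa (psi x) = psibar (kappa x).
    by apply: kappa_T => //; rewrite rhoK.
  have psibar_inj : injective psibar.
    move=> i j e; rewrite -[i]rhoK -[j]rhoK.
    have psiK x : phi (psi x) = x.
      by rewrite -[RHS]/((1%g : homeo X) x) -(mulgV phi).
    by rewrite -[rho i]psiK -[rho j]psiK; apply: kappa_T.
  have mF i : ((c psi (rho i))^-1 * val (u (psibar i)))%g \in F.
    apply: contraT => nF; have /negP := good (psibar i); case; apply/inner_boundaryP.
    split; first exact: valP.
    by exists (c psi (rho i))^-1%g => //; apply/SV/cS.
  pose u' : {ffun P -> F} := [ffun i => [` mF i]%fset].
  suff -> : precomp phi (w (u, q)) = w (u', perm psibar_inj * q)%g by [].
  apply/funext => x; rewrite /precomp /w /= -/psi psibarE permM permE ffunE /=.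
  congr (_, _); rewrite invgM invgK alphaM; congr (alpha _ _).
  rewrite -[LHS]/(psi x) (cP Tpsi); congr (alpha _ x).
  by apply: c_kappa => //; rewrite rhoK.
have F_gt0 : (0 < #|` F|)%N by rewrite cardfs_gt0.
have card_bad j : (#|bad j| * #|` F| = #|` inner_boundary S F| * #|` E|)%N.
  have -> : #|bad j| = (#|[pred u : {ffun P -> F} | bF (u j)]| * #|{perm P}|)%N.
    rewrite -[#|{perm P}|]/#|predT : pred {perm P}| -cardX.
    by apply: eq_card => uq; rewrite !inE andbT.
  rewrite mulnAC [X in (_ * X * _)%N]cardfE card_ffun_coord card_bF -cardfE card_E.
  by rewrite mulnA.
have leE : #|` action_boundary precomp T E|%:R <= (#|P|%:R * eta) * #|` E|%:R.
  apply: le_trans (_ : (\sum_(j : P) #|bad j|)%:R <= _).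
    rewrite ler_nat; apply: leq_trans (fsubset_leq_card bdE) _.
    apply: leq_trans (leq_imfset_card _ _ _) _; rewrite /= -cardE.
    exact: leq_card_exists.
  rewrite natr_sum -mulrA mulr_natl -sumr_const; apply: ler_sum => j _.
  have F_gt0' : 0 < #|` F|%:R :> R by rewrite ltr0n.
  rewrite -(ler_pM2r F_gt0') -natrM card_bad natrM mulrAC.
  by apply: ler_wpM2r.
have E0 : E != fset0.
  rewrite -cardfs_gt0 card_E muln_gt0 expn_gt0 F_gt0.
  by apply/card_gt0P; exists 1%g.
rewrite -card_E; apply: (@folner_transfer _ _ _ precomp) leE => //.
- by move=> y; apply/funext => x; rewrite /precomp invg1.
- by move=> g h y; apply/funext => x; rewrite /precomp invgM.
- exact: generated_group.
- exact: mem_generated.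
- move=> g y /imfsetP [[u q] /= _ ->] e.
  have gx x : (g^-1)%g x = x.
    have := congr1 (fun f : Y => f x) e; rewrite /precomp /w /= => -[+ /perm_inj kx].
    rewrite kx => /(congr1 (alpha (val (u (kappa x))))).
    by rewrite -!alphaM mulgV !alpha1.
  by apply/invg_inj; rewrite invg1; apply: homeo_ext.
Qed.

End Wreath.

(** * Numerical estimates *)

(** The Folner condition holds in the ambient group; restricting the set to one
    orbit of left multiplication by the subgroup makes it a subset of it. *)
Lemma amenable_folner_sizes (R : realType) (G : groupType) (S : {fset G})
    (eta : R) :
  amenable R G -> 0 < eta -> folner_sizes (generated S) S eta !=set0.
Proof.
move=> amG eta0; pose n := #|` S|.+1.
have n0 : 0 < n%:R :> R by rewrite ltr0n.
have [F [F0 Finv]] := amG S (eta / n%:R) (divr_gt0 eta0 n0).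
pose b (s : S) := [pred h : F | (val s * val h)%g \notin F].
have sub : (action_boundary ( *%g) S F `<=`
    [fset val h | h in [pred h : F | [exists s, b s h]]])%fset.
  apply/fsubsetP => h /action_boundaryP [Fh [s Ss sh]].
  apply/imfsetP; exists [` Fh]%fset => //=.
  suff : [exists s, b s [` Fh]%fset] by [].
  by apply/existsP; exists [` Ss]%fset.
have leb (s : S) : #|b s|%:R <= eta / n%:R * #|` F|%:R :> R.
  apply: le_trans (Finv _ (valP s)); rewrite ler_nat.
  have inj : injective (fun h : F => (val s * val h)%g).
    by move=> x y /mulgI/val_inj.
  have -> : #|b s| = #|` [fset (val s * val h)%g | h in b s]%fset|.
    by rewrite card_imfset; [rewrite -cardE | exact: inj].
  apply: fsubset_leq_card; apply/fsubsetP => g /imfsetP [h /= bh ->].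
  apply/fsetUP; left; apply/fsetDP; split; last exact: bh.
  by apply/imfsetP; exists (val h) => //; exact: valP.
have leF : #|` action_boundary ( *%g) S F|%:R <= eta * #|` F|%:R :> R.
  apply: le_trans (_ : (\sum_s #|b s|)%:R <= _).
    rewrite ler_nat; apply: leq_trans (fsubset_leq_card sub) _.
    apply: leq_trans (leq_imfset_card _ _ _) _; rewrite /= -cardE.
    exact: leq_card_exists.
  rewrite natr_sum; apply: le_trans (ler_sum _ (fun s _ => leb s)) _.
  rewrite sumr_const -cardfE -[leLHS]mulr_natl mulrA ler_wpM2r //.
  rewrite mulrCA ler_piMr ?(ltW eta0) // ler_pdivrMr // mul1r ler_nat.
  exact: leqnSn.
have mul_free (g y : G) : y \in F -> (g * y)%g = y -> g = 1%g.
  by move=> _ e; apply: (@mulIg _ y); rewrite mul1g.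
have [k Sk _] := folner_transfer (@mul1g G) (fun g h y => esym (mulgA g h y))
  (generated_group S) (@mem_generated G S) mul_free F0 leF.
by exists k.
Qed.

Section Delta.
Context {R : realType}.
Variables (t s l : nat) (eps : R).
Hypotheses (t0 : (0 < t)%N) (s0 : (0 < s)%N) (eps0 : 0 < eps).
Hypothesis ratio_le1 : 0 <= 1 - delta_ratio t s l eps.

Let d := delta t s l eps.
Let t1 : 1 <= t%:R :> R. Proof. by rewrite ler1n. Qed.
Let s1 : 1 <= s%:R :> R. Proof. by rewrite ler1n. Qed.
Let tp : 0 < 1 + 2 * t%:R :> R. Proof. by move: t1; lra. Qed.
Let sp : 0 < s%:R + 2 :> R. Proof. by move: s1; lra. Qed.
Let p0 : 0 < 2 ^+ l :> R. Proof. by rewrite exprn_gt0. Qed.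

Lemma delta_gt0 : 0 < d.
Proof.
have r0 : 0 < delta_ratio t s l eps.
  by rewrite divr_gt0 // !mulr_gt0 ?exprn_gt0 ?ltr0n.
rewrite /d /delta lt_min subr_gt0; apply/andP; split.
  by rewrite divr_gt0 // !mulr_gt0 ?exprn_gt0 ?ltr0n.
rewrite -[X in _ < X]sqrtr1 ltr_sqrt //.
by rewrite ltrBlDr ltrDl.
Qed.

Let d_le : d <=
  eps / ((1 + 2 * t%:R) * 2 ^+ l * t%:R ^+ 2 * (2 * s%:R * (s%:R + 2))).
Proof. by rewrite /d /delta ge_min lexx. Qed.

Lemma delta_le_eps : d <= eps / 2 ^+ l.
Proof.
apply: le_trans d_le _; rewrite ler_wpM2l ?(ltW eps0) // lef_pV2 ?posrE //; last first.
  by rewrite !mulr_gt0 ?exprn_gt0 ?ltr0n.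
rewrite -mulrA mulrAC -[X in X <= _]mul1r ler_wpM2r ?(ltW p0) //.
have tt : 1 <= t%:R ^+ 2 :> R by rewrite exprn_ege1.
have ss : 1 <= 2 * s%:R * (s%:R + 2) :> R by move: s1; nra.
have tq : 1 <= 1 + 2 * t%:R :> R by move: t1; lra.
by rewrite mulr_ege1 // mulr_ege1.
Qed.

(** The first term of the minimum is the ratio divided by s + 2, and the ratio
    is at most 1. *)
Lemma delta_le3 : d <= 3^-1.
Proof.
apply: le_trans d_le _.
have -> : eps / ((1 + 2 * t%:R) * 2 ^+ l * t%:R ^+ 2 * (2 * s%:R * (s%:R + 2))) =
   delta_ratio t s l eps / (s%:R + 2).
  by rewrite /delta_ratio -[RHS]mulrA -invfM -!mulrA.
rewrite ler_pdivrMr; last exact: sp.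
by move: ratio_le1 s1; lra.
Qed.

(** For d < 1/2 one has ln d < ln (1 - d) < 0, so the quotient exceeds 1. *)
Lemma num_levels_gt1 : (1 < num_levels d)%N.
Proof.
have d0 := delta_gt0; have d3 := delta_le3.
have ln1 : ln (1 - d) < 0 by rewrite ln_lt0 //; lra.
have x1 : 1 < ln d / ln (1 - d).
  by rewrite ltr_ndivlMr // mul1r ltr_ln ?posrE //; lra.
have c1 : (1 < Num.ceil (ln d / ln (1 - d)))%R by rewrite ceil_gt_int.
by rewrite /num_levels; move: c1; case: (Num.ceil _).
Qed.

End Delta.

Lemma folner_sizes_le {R : realType} {G : groupType} (L : set G) (Q : {fset G})
    (eps eps' : R) : eps <= eps' -> folner_sizes L Q eps `<=` folner_sizes L Q eps'.
Proof.
move=> le_eps k [F [F0 FL bF cF]]; exists F; split=> //.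
by apply: le_trans bF _; rewrite ler_wpM2r.
Qed.

Lemma eta1_le {R : realType} {G : groupType} (S : {fset G}) (d : R) :
  (0 < #|` S|)%N -> 0 < d -> 0 < Defs.eta S d 1 <= d.
Proof.
move=> S0 d0; rewrite /Defs.eta varphi1 big_nat1 Phi1 /eta_of.
have s1 : 1 <= #|` S|%:R :> R by rewrite ler1n.
have D1 : 1 <= 16 * #|` S|%:R * #|` S|%:R ^+ 2 * (#|` S|%:R + 1) :> R.
  have s2 : 1 <= #|` S|%:R ^+ 2 :> R by rewrite exprn_ege1.
  rewrite !mulr_ege1 //; lra.
have Dp := lt_le_trans ltr01 D1.
by rewrite divr_gt0 //= ler_pdivrMr // ler_peMr // ltW.
Qed.

(** * Cocycles and free points *)

Lemma compact_cantor_set (X : topologicalType) : cantor_set X -> compact [set: X].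
Proof.
move=> [f [_ [g [cg fK gK]]]].
have -> : [set: X] = g @` [set: cantor_space].
  by apply/seteqP; split => // x _; exists (f x).
apply: continuous_compact; last exact: cantor_space_compact.
exact: continuous_subspaceT.
Qed.

Section Cocycles.
Context {R : realType} {X : metricType R} {G : groupType}.
Variable alpha : G -> X -> X.
Hypothesis alphaP : continuous_action alpha.

Lemma orbit_cocycle_near (phi : homeo X) (c : X -> G) (x : X) :
  orbit_cocycle alpha phi c -> \forall x' \near x, c x' = c x.
Proof.
move=> [cc _].
exact: (cc x _ (discrete_set1 (c x : discrete_topology G))).
Qed.

Lemma free_point_near (V : set X) (x : X) : dense (free_points alpha) ->
  nbhs x V -> exists2 y, V y & free_points alpha y.
Proof.
move=> free_dense Vx.
have [||y [Vy fy]] := free_dense V^°.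
- by exists x.
- exact: open_interior.
by exists y => //; exact: interior_subset Vy.
Qed.

(** The value at a free point is forced, and cocycles are locally constant. *)
Lemma orbit_cocycle_unique (phi : homeo X) (c c' : X -> G) :
  dense (free_points alpha) ->
  orbit_cocycle alpha phi c -> orbit_cocycle alpha phi c' -> c = c'.
Proof.
move=> free_dense cP c'P; apply/funext => x.
have [y [cy c'y] fy] := free_point_near free_dense
  (filterI (orbit_cocycle_near x cP) (orbit_cocycle_near x c'P)).
have [_ a1 aM] := alphaP.
rewrite -cy -c'y.
have : ((c' y)^-1 * c y)%g = 1%g.
  by apply: fy; rewrite aM -(cP.2 y) (c'P.2 y) -aM mulVg a1.
by move/mulg1_eq; rewrite invgK.
Qed.

(** The classes are open and nonempty, so each contains a free point. *)
Lemma equivariant_free_partition (S : {fset G}) (T : {fset homeo X})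
    (c : homeo X -> X -> G) :
  compact [set: X] -> distal alpha -> dense (free_points alpha) ->
  (forall phi, phi \in T -> orbit_cocycle alpha phi (c phi)) ->
  (forall phi, phi \in T -> forall x, c phi x \in S) ->
  symmetric_fset S -> 1%g \in S ->
  exists (P : finType) (kappa : X -> P) (rho : P -> X),
    [/\ cancel rho kappa, forall i, free_points alpha (rho i),
        forall phi, phi \in T -> forall x y,
          kappa x = kappa y -> c phi x = c phi y
      & forall s, s \in S -> forall x y, kappa x = kappa y ->
          kappa (alpha s x) = kappa (alpha s y)].
Proof.
move=> cX alpha_distal free_dense cP cS SV S1.
have [|P [kappa [kappa_onto kappa_near kappa_c kappa_S]]] :=
  equivariant_partition cX alphaP alpha_distal S1 SV _ cS.
  by move=> phi Tphi x; exact: orbit_cocycle_near (cP _ Tphi).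
have rhoP i : exists y, kappa y = i /\ free_points alpha y.
  have [x <-] := kappa_onto i.
  by have [y ? ?] := free_point_near free_dense (kappa_near x); exists y.
have [rho rhoE] := choice rhoP.
exists P, kappa, rho; split=> // i; by have [] := rhoE i.
Qed.

End Cocycles.

(** * The bound *)

Theorem theoremA2 (R : realType) (X : metricType R) (G0 : groupType)
    (alpha : G0 -> X -> X) (T : {fset homeo X}) :
  cantor_set X ->
  infinite_set [set: G0] -> countable [set: G0] -> amenable R G0 ->
  continuous_action alpha -> distal alpha -> dense (free_points alpha) ->
  [set` T] `<=` topological_full_group alpha ->
  symmetric_fset T -> 1%g \in T ->
  exists l : nat,
    forall (c : homeo X -> X -> G0) (S : {fset G0}),
      (forall phi, phi \in T -> orbit_cocycle alpha phi (c phi)) ->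
      [set` S] = \bigcup_(phi in [set` T]) range (c phi) ->
      symmetric_fset S -> 1%g \in S ->
      forall eps : R, 0 < eps ->
        0 <= 1 - delta_ratio #|` T| #|` S| l eps ->
        let d := delta #|` T| #|` S| l eps in
        let n := num_levels d in
        folner_sizes (generated T) T eps !=set0 /\
        (folner (generated T) T eps <= (\sum_(1 <= i < n.+1) Phi S d i) ^ l)%N.
Proof.
move=> /compact_cantor_set cX _ _ G0_amenable alphaP alpha_distal free_dense _ TV T1.
(* By uniqueness of cocycles there is at most one S, so l may depend on it. *)
have [[c0 [S0 [c0P S0E S0V S01]]]|noS] := pselect (exists c S,
  [/\ forall phi, phi \in T -> orbit_cocycle alpha phi (c phi),
      [set` S] = \bigcup_(phi in [set` T]) range (c phi),
      symmetric_fset S & 1%g \in S]); last first.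
  by exists 0%N => c S ? ? ? ?; case: noS; exists c, S.
have c0S phi : phi \in T -> forall x, c0 phi x \in S0.
  move=> Tphi x; suff : [set` S0] (c0 phi x) by [].
  by rewrite S0E; exists phi => //; exists x.
have [P [kappa [rho [rhoK rho_free kappa_c kappa_S]]]] :=
  equivariant_free_partition alphaP cX alpha_distal free_dense c0P c0S S0V S01.
pose N := #|{perm P}|.
exists (#|P| + N)%N => c S cP SE SV S1 eps eps0 ratio_le1 d n.
have SS0 : S = S0.
  apply/fsetP => g; suff : [set` S] = [set` S0] by move=> e; apply/idP/idP;
    [rewrite -[X in X -> _]/([set` S] g) e|rewrite -[X in X -> _]/([set` S0] g) -e].
  rewrite SE S0E; apply: eq_bigcupr => phi Tphi.
  by rewrite (orbit_cocycle_unique alphaP free_dense (cP _ Tphi) (c0P _ Tphi)).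
subst S.
have s_gt0 : (0 < #|` S0|)%N by rewrite cardfs_gt0; apply/fset0Pn; exists 1%g.
have t_gt0 : (0 < #|` T|)%N by rewrite cardfs_gt0; apply/fset0Pn; exists 1%g.
have d0 : 0 < d by exact: delta_gt0.
have d_eps : d <= eps / 2 ^+ (#|P| + N) by exact: delta_le_eps.
have n1 : (1 < n)%N by exact: num_levels_gt1.
have /andP[eta0 eta_d] := eta1_le s_gt0 d0.
have [+ _] := min_natP (amenable_folner_sizes S0 G0_amenable eta0).
rewrite -/(folner _ _ _) -PhiS // => -[F [F0 _ bF cF]].
have [_ a1 aM] := alphaP.
have [k Tk lek] := folner_wreath a1 aM S0V TV c0S (fun phi Tphi => (c0P phi Tphi).2)
  kappa_c kappa_S rhoK (fun i => rho_free i) F0 bF.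
have P_eta : #|P|%:R * Defs.eta S0 d 1 <= eps.
  apply: le_trans (_ : 2 ^+ (#|P| + N) * d <= _); last first.
    by rewrite mulrC -ler_pdivlMr // exprn_gt0.
  apply: ler_pM => //; first exact: ltW.
  rewrite -natrX ler_nat; apply: leq_trans (leq_addr N _) _.
  exact/ltnW/ltn_expl.
have Teps := folner_sizes_le P_eta Tk.
have Tne : folner_sizes (generated T) T eps !=set0 by exists k.
split=> //; apply: leq_trans ((min_natP Tne).2 _ Teps) _.
apply: leq_trans lek _.
set sum := (\sum_(_ <= _ < _) _)%N.
have F_gt0 : (0 < #|` F|)%N by rewrite cardfs_gt0.
have sumE : (#|` S0| + #|` F| <= sum)%N.
  rewrite /sum big_ltn; last exact: ltnW.
  rewrite big_ltn; last exact: n1.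
  by rewrite addnA cF (Phi1 S0 d) leq_addr.
have S_sum : (0 < sum)%N by apply: leq_trans sumE; rewrite addn_gt0 s_gt0.
rewrite expnD leq_mul //.
  have [->|P0] := posnP #|P|; first by rewrite !expn0.
  by rewrite leq_exp2r // (leq_trans _ sumE) // leq_addl.
apply: leq_trans (ltnW (ltn_expl N (ltnSn 1))) _.
have [->|N0] := posnP N; first by rewrite !expn0.
by rewrite leq_exp2r // (leq_trans _ sumE) // (leq_add s_gt0 F_gt0).
Qed.
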